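(* For every $0<p\le 1$ there exists a constant $c_p$, depending only on $p$, such that the following holds for all $k\in\mathbb{N}$ and all integers $n$ with $2^k<n\le2^{k+1}$. If $0<p<1$, then for every $F\in H_p(G)$ $$\|S_nF-F\|_{H_p}\le c_p\,2^{d(n)(1/p-1)}\,\omega_{H_p}\!\left(\frac1{2^k},F\right),$$ and, for $p=1$, for every $F\in H_1(G)$ $$\|S_nF-F\|_{H_1}\le c_1\,V(n)\,\omega_{H_1}\!\left(\frac1{2^k},F\right).$$
   Context: $\mathbb{N}_+$ is the set of positive integers and $\mathbb{N}=\mathbb{N}_+\cup\{0\}$. $G=\prod_{k=0}^\infty Z_2$ is the dyadic (Walsh) group, i.e. the set of sequences $x=(x_0,x_1,\dots)$, $x_k\in\{0,1\}$, with coordinatewise addition mod 2, product topology, and normalized Haar measure $\mu$ (the product of the measures giving mass $1/2$ to each point of $Z_2$). Put $I_0(x)=G$, $I_n(x)=\{y\in G: y_0=x_0,\dots,y_{n-1}=x_{n-1}\}$, and let $\zeta_n$ be the $\sigma$-algebra generated by $\{I_n(x):x\in G\}$. For $n\in\mathbb{N}_+$ with binary expansion $n=\sum_{j\ge0}n_j2^j$, $n_j\in\{0,1\}$, put $\langle n\rangle=\min\{j:n_j\ne0\}$, $|n|=\max\{j:n_j\neq0\}$, $d(n)=|n|-\langle n\rangle$, and let the variation of $n$ be $V(n)=n_0+\sum_{k=1}^\infty|n_k-n_{k-1}|$. Rademacher functions: $r_k(x)=(-1)^{x_k}$. Walsh functions: $w_n(x)=\prod_{k\ge0}r_k(x)^{n_k}$,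 $n\in\mathbb{N}$. A martingale $F=(F_n,n\in\mathbb{N})$ is a martingale with respect to $(\zeta_n)_{n\in\mathbb N}$. Its maximal function is $F^*=\sup_n|F_n|$; for $0<p<\infty$, $H_p(G)$ is the space of martingales with $\|F\|_{H_p}:=\|F^*\|_p<\infty$, where $\|f\|_p^p=\int_G|f|^p\,d\mu$. Walsh–Fourier coefficients of a martingale: $\widehat F(k)=\lim_{n\to\infty}\int_GF_nw_k\,d\mu$ (the limit always exists). Partial sums: $S_nF=\sum_{k=0}^{n-1}\widehat F(k)w_k$; in particular $S_{2^n}F=F_n$. An integrable function $f$ (such as $S_nF$) is identified with the martingale $(E(f\mid\zeta_n))_{n}$ of its conditional expectations, so that $S_nF-F$ is a martingale. The modulus of continuity in $H_p(G)$, $0<p\le1$, is $\omega_{H_p}(1/2^n,F):=\|F-S_{2^n}F\|_{H_p}$. *)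

(* Defs.v *)
From HB Require Import structures.
From mathcomp Require Import all_boot all_order all_algebra.
From mathcomp Require Import all_classical all_reals all_analysis.
From mathcomp Require Import measurable_realfun ring lra.

Set Implicit Arguments.
Unset Strict Implicit.
Unset Printing Implicit Defensive.

Import Order.TTheory GRing.Theory Num.Theory.
Import numFieldNormedType.Exports.

Local Open Scope classical_set_scope.
Local Open Scope ring_scope.

(* [cantor_space] is bool^nat with the product topology; its Borel sets are the
   measurable sets. *)
Definition dyadic : Type := g_sigma_algebraType (@open cantor_space).

Definition cylinder (n : nat) (x : dyadic) : set dyadic :=
  [set y | forall k, (k < n)%N -> y k = x k].

Definition zeta (n : nat) : set (set dyadic) := <<s range (cylinder n) >>.

(* [mu] is the product of the measures [fun A => #|A| / 2] on bool; this
   determines [mu], and [haar_exists] below shows that there is such a [mu]. *)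
Definition is_haar (R : realType) (mu : probability dyadic R) : Prop :=
  forall (n : nat) (A : nat -> pred bool),
    mu [set x | forall k, (k < n)%N -> A k (x k)] =
    (\prod_(k < n) (#|A k|%:R / 2))%:E.

Lemma open_coord k b : @open cantor_space [set x | x k = b].
Proof.
rewrite openE => x /= xk; rewrite /interior.
apply: (@proj_continuous nat (fun=> bool) k x [set b]).
by apply: open_nbhs_nbhs; split => //; exact: discrete_open.
Qed.

Lemma measurable_coord k (A : pred bool) :
  measurable [set x : dyadic | A (x k)].
Proof.
have m b : measurable [set x : dyadic | x k = b].
  by apply: sub_sigma_algebra; exact: open_coord.
have -> : [set x : dyadic | A (x k)] =
    \big[setU/set0]_(b <- [:: false; true] | A b) [set x : dyadic | x k = b].
  rewrite !big_cons big_nil setU0.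
  by apply/seteqP; split => x /=; case Af: (A false); case At: (A true) => /=;
    case: (x k); rewrite ?Af ?At; intuition congruence.
by apply: bigsetU_measurable => b _.
Qed.

Lemma rectE n (A : nat -> pred bool) :
  [set x : dyadic | forall k, (k < n)%N -> A k (x k)] =
  \big[setI/setT]_(k < n) [set x : dyadic | A k (x k)].
Proof.
rewrite -(bigcap_mkord n (fun k => [set x : dyadic | A k (x k)])).
by apply/seteqP; split => x h k /=; exact: h.
Qed.

Lemma measurable_rect n (A : nat -> pred bool) :
  measurable [set x : dyadic | forall k, (k < n)%N -> A k (x k)].
Proof.
by rewrite rectE; apply: bigsetI_measurable => k _; exact: measurable_coord.
Qed.

Lemma cylinderE n x :
  cylinder n x = [set y : dyadic | forall k, (k < n)%N -> pred1 (x k) (y k)].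
Proof. by apply/seteqP; split => y h k kn; apply/eqP; apply: h. Qed.

Lemma measurable_cylinder n x : measurable (cylinder n x : set dyadic).
Proof. by rewrite cylinderE; exact: (measurable_rect n (fun k => pred1 (x k))). Qed.

Lemma nbhs_cylinder (x : cantor_space) (U : set cantor_space) :
  nbhs x U -> exists n, cylinder n x `<=` U.
Proof.
pose F : set_system (nat -> bool) := filter_from setT (fun n => cylinder n x).
have FF : Filter F.
  apply: filter_from_filter; first by exists 0%N.
  move=> i j _ _; exists (maxn i j) => // y yx; split => k kn; apply: yx.
    by rewrite leq_max kn.
  by rewrite leq_max kn orbT.
have : {ptws, F --> (x : nat -> bool)}.
  apply/pointwise_cvgP => t V /= /nbhs_singleton Vx.
  by exists t.+1 => // y yx /=; rewrite yx.
by move=> /[apply] -[n _ nU]; exists n.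
Qed.

Lemma open_bigcup (U : set cantor_space) : open U ->
  U = \bigcup_(s in [set s : seq bool | cylinder (size s) (nth false s) `<=` U])
        cylinder (size s) (nth false s).
Proof.
move=> oU; apply/seteqP; split => [x Ux|x [s sU /sU//]].
have [n nU] := nbhs_cylinder (open_nbhs_nbhs (conj oU Ux)).
have e : cylinder (size (mkseq x n)) (nth false (mkseq x n)) = cylinder n x.
  by rewrite size_mkseq; apply/seteqP; split => y yx k kn;
    rewrite yx// nth_mkseq.
by exists (mkseq x n); rewrite /= e.
Qed.

(* Existence: the image of Lebesgue measure on [0, 1[ under binary digits. *)
Section haar_exists.
Variable R : realType.

Definition digit (t : R) : dyadic :=
  fun k => odd (Num.truncn (2 ^+ k.+1 * t)).

Lemma measurable_digit_coord k b : measurable [set t : R | digit t k = b].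
Proof.
have -> : [set t : R | digit t k = b] =
   \bigcup_(j in [set j | odd j = b])
     [set t | Num.truncn (2 ^+ k.+1 * t) = j].
  by apply/seteqP; split => [t td|t [j /= jb tj]];
    [exists (Num.truncn (2 ^+ k.+1 * t))|rewrite /= /digit tj].
apply: bigcup_measurable => j _.
have m n : measurable [set t : R | (Num.truncn (2 ^+ k.+1 * t) <= n)%N].
  have -> : [set t : R | (Num.truncn (2 ^+ k.+1 * t) <= n)%N] =
            [set` `]-oo, n.+1%:R / 2 ^+ k.+1[].
    apply/seteqP; split => t /=; rewrite in_itv/= truncn_le_nat.
      by rewrite ltr_pdivlMr ?exprn_gt0// mulrC.
    by rewrite ltr_pdivlMr ?exprn_gt0// mulrC.
  exact: measurable_itv.
case: j => [|j].
  have -> : [set t : R | Num.truncn (2 ^+ k.+1 * t) = 0%N] =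
            [set t : R | (Num.truncn (2 ^+ k.+1 * t) <= 0)%N].
    by apply/seteqP; split => t /=; rewrite leqn0 => /eqP.
  exact: m.
have -> : [set t : R | Num.truncn (2 ^+ k.+1 * t) = j.+1] =
    [set t : R | (Num.truncn (2 ^+ k.+1 * t) <= j.+1)%N] `\`
    [set t : R | (Num.truncn (2 ^+ k.+1 * t) <= j)%N].
  apply/seteqP; split => t /=.
    by move=> ->; split => //; rewrite ltnn.
  by move=> [tj /negP]; rewrite -ltnNge => jt; apply/eqP; rewrite eqn_leq tj.
exact: measurableD.
Qed.

Lemma measurable_digit : measurable_fun setT digit.
Proof.
apply: (@measurability _ _ _ _ setT digit (@open cantor_space)) => //.
move=> _ [U oU <-]; rewrite setTI (open_bigcup oU) preimage_bigcup.
rewrite bigcup_mkcond; apply: countable_bigcupT_measurable => // s.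
case: ifP => // _.
have -> : digit @^-1` cylinder (size s) (nth false s) =
   \big[setI/setT]_(k < size s) [set t | digit t k = nth false s k].
  rewrite -(bigcap_mkord _ (fun k => [set t | digit t k = nth false s k])).
  by apply/seteqP; split => t h k /=; exact: h.
by apply: bigsetI_measurable => k _; exact: measurable_digit_coord.
Qed.

Let mI : measurable (`[0, 1[%classic : set R).
Proof. exact: measurable_itv. Qed.


Definition unit_interval_measure := mrestr (@lebesgue_measure R) mI.
HB.instance Definition _ := Measure.on unit_interval_measure.

Definition haar_witness : set dyadic -> \bar R :=
  pushforward unit_interval_measure digit.

Let haar_witness0 : haar_witness set0 = 0%E.
Proof. by rewrite /haar_witness /pushforward preimage_set0 measure0. Qed.

Let haar_witness_ge0 A : (0 <= haar_witness A)%E.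
Proof. by rewrite /haar_witness /pushforward measure_ge0. Qed.

Let haar_witness_sigma_additive : semi_sigma_additive haar_witness.
Proof.
exact: (@measure_semi_sigma_additive _ _ _
  (@measure_function_pushforward__canonical__measure_function_Measure _ _ _ _ _ unit_interval_measure _ measurable_digit)).
Qed.

HB.instance Definition _ := isMeasure.Build _ _ _ haar_witness
  haar_witness0 haar_witness_ge0 haar_witness_sigma_additive.

Let binary_itv m j : interval R :=
  `[j%:R / 2 ^+ m, j.+1%:R / 2 ^+ m[.

Lemma measurable_digit_rect m n (A : nat -> pred bool) :
  measurable [set t : R | forall k, (k < n)%N -> A (m + k)%N (digit t (m + k)%N)].
Proof.
rewrite (_ : [set _ | _] = \big[setI/setT]_(k < n)
   digit @^-1` [set x : dyadic | A (m + k)%N (x (m + k)%N)]).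
  apply: bigsetI_measurable => k _; rewrite -[X in measurable X]setTI.
  by apply: measurable_digit => //; exact: measurable_coord.
rewrite -(bigcap_mkord n
  (fun k => digit @^-1` [set x : dyadic | A (m + k)%N (x (m + k)%N)])).
by apply/seteqP; split => x h k /=; exact: h.
Qed.

Lemma binary_itv_split m j :
  [set` binary_itv m j] =
  [set` binary_itv m.+1 j.*2] `|` [set` binary_itv m.+1 j.*2.+1].
Proof.
have p : 0 < 2 ^+ m :> R by rewrite exprn_gt0.
have e0 : j.*2%:R = j%:R * 2 :> R by rewrite -muln2 natrM.
have e1 : j.*2.+1%:R = j%:R * 2 + 1 :> R by rewrite -e0 natr1.
have e2 : j.*2.+2%:R = j%:R * 2 + 2 :> R by rewrite -e0 -natrD addn2.
have e3 : j.+1%:R = j%:R + 1 :> R by rewrite natr1.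
apply/seteqP; split => t; rewrite /binary_itv /= !in_itv/= !exprS
  !ler_pdivrMr ?mulr_gt0// !ltr_pdivlMr ?mulr_gt0// e0 e1 e2 e3.
  move=> /andP[t1 t2].
  by have [t3|t3] := ltP (t * (2 * 2 ^+ m)) (j%:R * 2 + 1); [left|right];
    apply/andP; split; lra.
by case=> /andP[t1 t2]; apply/andP; split; lra.
Qed.

Lemma binary_itv_digit m j t :
  [set` binary_itv m.+1 j] t -> digit t m = odd j.
Proof.
rewrite /binary_itv/= in_itv/= ler_pdivrMr ?exprn_gt0// ltr_pdivlMr ?exprn_gt0//.
by rewrite mulrC => tj; rewrite /digit (truncn_def tj).
Qed.

Lemma lebesgue_digit_rect n m j (A : nat -> pred bool) :
  lebesgue_measure ([set t : R | forall k, (k < n)%N ->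
     A (m + k)%N (digit t (m + k)%N)] `&` [set` binary_itv m j]) =
  (2 ^- m * \prod_(k < n) (#|A (m + k)%N|%:R / 2))%:E.
Proof.
elim: n m j => [|n ih] m j.
  rewrite big_ord0 mulr1 (_ : [set _ | _] = setT); last exact/seteqP.
  rewrite setTI lebesgue_measure_itv/= lte_fin ltr_pM2r ?invr_gt0 ?exprn_gt0//.
  by rewrite ltr_nat ltnSn -EFinB -mulrBl -natr1 addrAC subrr add0r mul1r.
have E i : [set t : R | forall k, (k < n.+1)%N -> A (m + k)%N (digit t (m + k)%N)]
    `&` [set` binary_itv m.+1 i] =
    if A m (odd i) then [set t : R | forall k, (k < n)%N ->
      A (m.+1 + k)%N (digit t (m.+1 + k)%N)] `&` [set` binary_itv m.+1 i] else set0.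
  case: ifP => Ai; apply/seteqP; split => t //=.
  - by move=> [h ti]; split => // k kn; have := h k.+1 kn; rewrite addnS.
  - move=> [h ti]; split => // -[_|k kn]; last by have := h k kn; rewrite addnS.
    by rewrite addn0 (binary_itv_digit ti).
  - by move=> [/(_ 0%N isT)]; rewrite addn0 => + /binary_itv_digit e; rewrite e Ai.
have L i : lebesgue_measure ([set t : R | forall k, (k < n.+1)%N ->
    A (m + k)%N (digit t (m + k)%N)] `&` [set` binary_itv m.+1 i]) =
    ((A m (odd i))%:R * (2 ^- m.+1 * \prod_(k < n) (#|A (m.+1 + k)%N|%:R / 2)))%:E.
  by rewrite E; case: ifP => _; rewrite ?ih ?mul1r// measure0 mul0r.
rewrite binary_itv_split setIUr measureU; first last.
- rewrite -subset0 => t [[_ /binary_itv_digit e1] [_ /binary_itv_digit]].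
  by rewrite e1 /= odd_double.
- by apply: measurableI; [exact: measurable_digit_rect|exact: measurable_itv].
- by apply: measurableI; [exact: measurable_digit_rect|exact: measurable_itv].
apply: eq_trans (congr2 (fun x y => (x + y)%E) (L _) (L _)) _.
rewrite /= odd_double -EFinD big_ord_recl addn0.
under eq_bigr do rewrite addSnnS.
congr EFin; set P := \prod_(_ < n) _.
have -> : #|A m| = (A m true + A m false)%N.
  by rewrite -sum1_card big_mkcond/= big_bool !unfold_in; case: (A m true); case: (A m false).
by rewrite natrD exprS invfM; ring.
Qed.

Lemma haar_witnessE n (A : nat -> pred bool) :
  haar_witness [set x | forall k, (k < n)%N -> A k (x k)] =
  (\prod_(k < n) (#|A k|%:R / 2))%:E.
Proof.
have := lebesgue_digit_rect n 0 0 A.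
by rewrite expr0 invr1 mul1r => <-; rewrite /binary_itv expr0 !divr1.
Qed.

Let haar_witness_setT : haar_witness setT = 1%E.
Proof.
have := haar_witnessE 0 (fun=> predT); rewrite big_ord0 => <-.
by congr haar_witness; apply/seteqP; split.
Qed.

HB.instance Definition _ :=
  Measure_isProbability.Build _ _ _ haar_witness haar_witness_setT.

Lemma haar_exists : exists mu : probability dyadic R, is_haar mu.
Proof.
exists (haar_witness : probability dyadic R); exact: haar_witnessE.
Qed.

End haar_exists.

Lemma haar_cylinder (R : realType) (mu : probability dyadic R) n x :
  is_haar mu -> mu (cylinder n x) = (2 ^- n)%:E.
Proof.
move=> h; rewrite cylinderE (h n (fun k => pred1 (x k))); congr EFin.
under eq_bigr do rewrite card1 mul1r.
by rewrite prodr_const card_ord exprVn.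
Qed.

Definition bit (n j : nat) : bool := odd (n %/ 2 ^ j).

(* Hence sums, products and extrema over the digits of [n] may be restricted to
   positions below [n]. *)
Lemma bit_large n j : (n <= j)%N -> bit n j = false.
Proof.
move=> nj; rewrite /bit divn_small//.
by rewrite (leq_ltn_trans nj)// ltn_expl.
Qed.

Definition low_bit (n : nat) : nat := \big[minn/n]_(j < n | bit n j) j.
Definition high_bit (n : nat) : nat := \max_(j < n | bit n j) j.
Definition bit_spread (n : nat) : nat := high_bit n - low_bit n.

Definition bit_variation (n : nat) : nat :=
  bit n 0 + \sum_(1 <= k < n.+1) `|bit n k - bit n k.-1|.

Section walsh.
Variable R : realType.

Definition rademacher (k : nat) (x : dyadic) : R := (-1) ^+ x k.

Definition walsh (n : nat) (x : dyadic) : R :=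
  \prod_(k < n) rademacher k x ^+ bit n k.

End walsh.
Arguments walsh : clear implicits.

Section martingales.
Variables (R : realType) (mu : probability dyadic R).

Definition zeta_measurable (n : nat) (f : dyadic -> R) : Prop :=
  forall B : set R, measurable B -> zeta n (f @^-1` B).

Definition is_cond_exp (n : nat) (f g : dyadic -> R) : Prop :=
  [/\ zeta_measurable n g, mu.-integrable setT (EFin \o g) &
      forall A, zeta n A ->
        (\int[mu]_(x in A) (g x)%:E = \int[mu]_(x in A) (f x)%:E)%E].

(* Since cylinders have positive measure, E(f | zeta_n) is unique as a function
   and not only almost everywhere; see [cond_expP] and [is_cond_exp_uniq]. *)
Definition cond_exp (n : nat) (f : dyadic -> R) : dyadic -> R :=
  xget (cst 0) [set g | is_cond_exp n f g].

(* Adaptedness and integrability are part of [is_cond_exp]. *)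
Definition martingale (F : nat -> dyadic -> R) : Prop :=
  forall n, is_cond_exp n (F n.+1) (F n).

Definition maximal_function (F : nat -> dyadic -> R) (x : dyadic) : \bar R :=
  ereal_sup (range (fun n => `|F n x|%:E)).

Definition Hnorm (p : R) (F : nat -> dyadic -> R) : \bar R :=
  ('N[mu]_p%:E [maximal_function F])%E.

Definition hardy (p : R) (F : nat -> dyadic -> R) : Prop :=
  martingale F /\ (Hnorm p F < +oo)%E.

Definition fourier_coef (F : nat -> dyadic -> R) (k : nat) : R :=
  limn (fun n => \int[mu]_x (F n x * walsh R k x)).

Definition partial_sum (n : nat) (F : nat -> dyadic -> R) (x : dyadic) : R :=
  \sum_(k < n) fourier_coef F k * walsh R k x.

(* The martingale identified with an integrable function. *)
Definition martingale_of (f : dyadic -> R) : nat -> dyadic -> R :=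
  fun m => cond_exp m f.

Definition martingale_sub (F1 F2 : nat -> dyadic -> R) : nat -> dyadic -> R :=
  fun m x => F1 m x - F2 m x.

(* omega_{H_p}(1 / 2^k, F) *)
Definition modulus (p : R) (k : nat) (F : nat -> dyadic -> R) : \bar R :=
  Hnorm p (martingale_sub F (martingale_of (partial_sum (2 ^ k) F))).

End martingales.

Lemma zeta_cylinder n A x y :
  zeta n A -> A x -> cylinder n x y -> A y.
Proof.
pose S := [set A : set dyadic | forall x y, cylinder n x y -> A x <-> A y].
suff SA : zeta n `<=` S by move=> zA Ax xy; exact: (SA A zA x y xy).1 Ax.
apply: smallest_sub; first split => //.
- by move=> B SB u v uv; rewrite setTD /setC /=; rewrite (SB u v uv).
- move=> B SB u v uv; split => -[i _ ?]; exists i => //.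
    by rewrite -(SB i u v uv).
  by rewrite (SB i u v uv).
move=> _ [z _ <-] u v uv; split => h k kn; first by rewrite uv// h.
by rewrite -uv// h.
Qed.

Definition cylinder_point n (s : n.-tuple bool) : dyadic := nth false s.

Lemma cylinder_cover n (x : dyadic) :
  exists s : n.-tuple bool, cylinder n (cylinder_point s) = cylinder n x.
Proof.
have sz : size (mkseq x n) == n by rewrite size_mkseq.
exists (Tuple sz); apply/seteqP; split => y yx k kn;
  by rewrite yx// /cylinder_point nth_mkseq.
Qed.

Lemma zeta_bigcup n (A : set dyadic) :
  (forall x y, A x -> cylinder n x y -> A y) ->
  A = \big[setU/set0]_(s : n.-tuple bool | `[< A (cylinder_point s) >])
        cylinder n (cylinder_point s).
Proof.
move=> sA; rewrite -bigcup_seq_cond; apply/seteqP; split => [x Ax|x].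
  have [s sx] := cylinder_cover n x.
  exists s; last by rewrite sx.
  rewrite /= mem_index_enum; apply/asboolP/(sA x) => //.
  by rewrite -sx.
by move=> [s /= /andP[_ /asboolP]]; exact: sA.
Qed.

Lemma zetaP n (A : set dyadic) :
  zeta n A <-> (forall x y, A x -> cylinder n x y -> A y).
Proof.
split=> [zA x y|sA]; first exact: zeta_cylinder.
rewrite (zeta_bigcup sA).
apply: (@bigsetU_measurable _ (g_sigma_algebraType (range (cylinder n)))).
move=> s _; apply: sub_sigma_algebra; exists (cylinder_point s) => //.
Qed.

Lemma zeta_measurableP (R : realType) n (f : dyadic -> R) :
  zeta_measurable n f <-> (forall x y, cylinder n x y -> f x = f y).
Proof.
split=> [mf x y xy|sf B _].
  have /zetaP/(_ x y erefl xy) // : zeta n (f @^-1` [set f x]) by exact: mf.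
by apply/zetaP => x y; rewrite /= => + /sf => + <-.
Qed.

Lemma zeta_measurable_measurable (R : realType) n (f : dyadic -> R) :
  zeta_measurable n f -> measurable_fun setT f.
Proof.
move=> mf _ B mB; rewrite setTI.
suff : zeta n `<=` @measurable _ dyadic by apply; exact: mf.
apply: smallest_sub; first exact: sigma_algebra_measurable.
by move=> _ [x _ <-]; exact: measurable_cylinder.
Qed.

Section cond_exp_theory.
Context (R : realType) (mu : probability dyadic R) (mu_haar : is_haar mu).

Lemma is_cond_exp_mean n f g x : is_cond_exp mu n f g ->
  g x = 2 ^+ n * \int[mu]_(y in cylinder n x) f y.
Proof.
move=> [/zeta_measurableP mg _ /(_ (cylinder n x))].
have zx : zeta n (cylinder n x) by apply: sub_sigma_algebra; exists x.
move=> /(_ zx) e; rewrite /Rintegral -e.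
under eq_integral => y /set_mem yx do rewrite -(mg x y yx).
rewrite integral_cst; last exact: measurable_cylinder.
have := haar_cylinder n x mu_haar => /= -> /=.
by rewrite mulrC divfK ?expf_neq0.
Qed.

Lemma is_cond_exp_uniq n f g1 g2 :
  is_cond_exp mu n f g1 -> is_cond_exp mu n f g2 -> g1 = g2.
Proof.
by move=> h1 h2; apply/funext => x; rewrite !(is_cond_exp_mean _ h1, is_cond_exp_mean _ h2).
Qed.

Lemma cond_expP n f : mu.-integrable setT (EFin \o f) ->
  is_cond_exp mu n f (cond_exp mu n f).
Proof.
move=> intf.
pose g x := 2 ^+ n * \int[mu]_(y in cylinder n x) f y.
suff cg : is_cond_exp mu n f g by exact: (@xgetI _ _ [set h | is_cond_exp mu n f h] g).
have gE x y : cylinder n x y -> g x = g y.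
  move=> xy; rewrite /g (_ : cylinder n x = cylinder n y)//.
  by apply/seteqP; split => z zx k kn; rewrite zx// xy.
have mg : zeta_measurable n g by apply/zeta_measurableP.
have mg' := zeta_measurable_measurable mg.
have mf : measurable_fun setT f.
  by apply/measurable_EFinP; exact: measurable_int intf.
have intfc x : mu.-integrable (cylinder n x) (EFin \o f).
  by apply: integrableS intf => //; exact: measurable_cylinder.
split=> //.
- apply: measurable_bounded_integrable => //.
    by have := probability_setT mu => /= ->; rewrite ltry.
  exists (2 ^+ n * \int[mu]_y `|f y|); split => [|M Mlt x _ /=].
    exact: num_real.
  apply: le_trans (ltW Mlt); rewrite /g normrM ger0_norm ?exprn_ge0//.
  rewrite ler_pM2l ?exprn_gt0//.
  apply: le_trans (le_normr_Rintegral _ (intfc x)) _.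
    exact: measurable_cylinder.
  rewrite /Rintegral fine_le//.
  + apply: integrable_fin_num; first exact: measurable_cylinder.
    exact: integrable_norm.
  + by apply: integrable_fin_num => //; exact: integrable_norm.
  + apply: ge0_subset_integral => //; first exact: measurable_cylinder.
    by apply/measurable_EFinP; exact: measurableT_comp.
move=> A /zetaP sA; rewrite (zeta_bigcup sA) -big_filter.
have tI : trivIset [set` [seq s <- index_enum {: n.-tuple bool} |
      `[< A (cylinder_point s) >]]] (fun s : n.-tuple bool => cylinder n (cylinder_point s)).
  move=> s t _ _ [z [zs zt]]; apply/val_inj/(@eq_from_nth _ false).
    by rewrite !size_tuple.
  by move=> k; rewrite size_tuple => kn; rewrite -/(cylinder_point s k) -(zs k kn) (zt k kn).
have fu : uniq [seq s <- index_enum {: n.-tuple bool} |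
      `[< A (cylinder_point s) >]] by rewrite filter_uniq// index_enum_uniq.
have mc (s : n.-tuple bool) : measurable (cylinder n (cylinder_point s) : set dyadic).
  exact: measurable_cylinder.
rewrite !integral_bigsetU_EFin//; last 2 first.
- by apply: measurable_funTS; exact/measurable_EFinP.
- by apply: measurable_funTS; exact/measurable_EFinP.
apply: eq_bigr => s _; move: (cylinder_point s) => x.
under eq_integral => y /set_mem yx do rewrite -(gE x y yx).
rewrite integral_cst; last exact: measurable_cylinder.
have := haar_cylinder n x mu_haar => /= ->.
rewrite -EFinM /g mulrAC mulfV ?expf_neq0// mul1r.
rewrite /Rintegral fineK//; apply: integrable_fin_num => //.
exact: measurable_cylinder.
Qed.

End cond_exp_theory.

(* Main.v *)
Require Import Defs.
From mathcomp Require Import all_boot all_order all_algebra.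
From mathcomp Require Import all_classical all_reals all_analysis.
From mathcomp Require Import measurable_realfun ring lra zify.

Set Implicit Arguments.
Unset Strict Implicit.
Unset Printing Implicit Defensive.

Import Order.TTheory GRing.Theory Num.Theory.
Import numFieldNormedType.Exports.

Local Open Scope classical_set_scope.
Local Open Scope ring_scope.

(* Put G = F - S_{2^k} F and M = k + 2. Since E(S_n F | zeta_m) - F_m vanishes for
   m <= k and equals (S_n F - S_{2^k} F) - G_m for m > k, the maximal function of
   S_n F - F is at most |S_n F - S_{2^k} F| + G^*. Moreover S_n F - S_{2^k} F is the
   convolution of G_M with the Dirichlet kernel D_n, both of which depend on M
   coordinates only, so that it is a sum over the 2^M points of the finite group
   Z_2^M and subadditivity of t^p gives
     ||S_n F - S_{2^k} F||_p^p <= 2^(M(1-p)) ||D_n||_p^p ||G_M||_p^p.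
   It remains to bound ||D_n||_p^p by a multiple
   of 2^(<n>(p-1)) if p < 1, and ||D_n||_1 by V(n). Both follow by appending binary
   digits to n: if a is the first coordinate of the argument and x the remaining
   ones, then D_{2n}(a, x) = (1 + (-1)^a) D_n(x), and D_{2n+1} differs from D_{2n}
   and from D_{2n+2} by a single Walsh function. *)

(** * The dyadic group and binary digits *)

Definition dyadic_cons (b : bool) (x : dyadic) : dyadic :=
  fun k => if k is k'.+1 then x k' else b.

Definition dyadic_add (x y : dyadic) : dyadic := fun k => x k (+) y k.

Definition dyadic_tail (x : dyadic) : dyadic := fun k => x k.+1.

Lemma dyadic_add_cons b x y :
  dyadic_add (dyadic_cons b x) y = dyadic_cons (b (+) y 0%N) (dyadic_add x (dyadic_tail y)).
Proof. by apply/funext => -[|k]. Qed.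

Lemma bit0 (b : bool) n : bit (b + n.*2) 0 = b.
Proof. by rewrite /bit expn0 divn1 oddD odd_double addbF oddb. Qed.

Lemma bitS (b : bool) n k : bit (b + n.*2) k.+1 = bit n k.
Proof. by rewrite /bit expnS divnMA divn2 half_bit_double. Qed.

Lemma bit_lt M n k : (n < 2 ^ M)%N -> bit n k -> (k < M)%N.
Proof.
move=> nM; rewrite ltnNge; apply: contraL => Mk.
by rewrite /bit divn_small// (leq_trans nM)// leq_exp2l.
Qed.

(** * Walsh functions, averages over the finite groups Z_2^M, Dirichlet kernels *)

Section walsh_theory.
Variable R : realType.

Notation w := (walsh R).

Lemma walsh_widen N n x : (n <= N)%N ->
  w n x = \prod_(k < N) rademacher R k x ^+ bit n k.
Proof.
move=> nN; rewrite /walsh -!(big_mkord predT (fun k => rademacher R k x ^+ bit n k)).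
rewrite (big_cat_nat _ (n := n) (p := N))//= [X in _ * X]big_nat_cond
  [X in _ * X]big1 ?mulr1//.
by move=> i; rewrite andbT => /andP[ni _]; rewrite bit_large.
Qed.

Lemma walsh0 x : w 0 x = 1. Proof. by rewrite /walsh big_ord0. Qed.

(** The lowest digit of the index meets the first coordinate of the point, so one Rademacher factor
    splits off. *)
Lemma walsh_cons (b a : bool) n x :
  w (b + n.*2) (dyadic_cons a x) = (-1) ^+ (a && b) * w n x.
Proof.
rewrite (@walsh_widen (b + n.*2).+1)// big_ord_recl /=.
congr (_ * _); first by rewrite bit0 /rademacher /=; case: a; case: b; rewrite ?expr1 ?expr0.
rewrite (@walsh_widen (b + n.*2) n); last by lia.
by apply: eq_bigr => i _; rewrite /= /bump /= add1n bitS.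
Qed.

Lemma walsh_add n x y : w n (dyadic_add x y) = w n x * w n y.
Proof.
rewrite /walsh -big_split /=; apply: eq_bigr => k _.
rewrite /rademacher /dyadic_add -exprMn; congr (_ ^+ _).
by case: (x k); case: (y k); rewrite /= ?expr0 ?expr1 ?mulr1 ?mul1r ?mulrNN ?mulr1.
Qed.

Lemma walsh_norm n x : `|w n x| = 1.
Proof.
rewrite /walsh normr_prod big1// => k _.
by rewrite /rademacher !normrX normrN1 !expr1n.
Qed.

Lemma walsh_cylinder M n : (n < 2 ^ M)%N ->
  forall x y, cylinder M x y -> w n x = w n y.
Proof.
move=> nM x y xy; apply: eq_bigr => k _; rewrite /rademacher.
by case: (boolP (bit n k)) => [/(bit_lt nM) /xy ->|_].
Qed.

(** On functions of the first [M] coordinates this is the Haar integral, see [Rintegral_avg]; as a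
    finite sum it allows induction on [M]. *)
Definition avg (M : nat) (f : dyadic -> R) : R :=
  2 ^- M * \sum_(s : M.-tuple bool) f (cylinder_point s).

Lemma avgS M f :
  avg M.+1 f = (avg M (f \o dyadic_cons false) + avg M (f \o dyadic_cons true)) / 2.
Proof.
rewrite /avg.
have -> : \sum_(s : M.+1.-tuple bool) f (cylinder_point s) =
   \sum_(b : bool) \sum_(s : M.-tuple bool) f (dyadic_cons b (cylinder_point s)).
  rewrite pair_big /=.
  rewrite (reindex (fun bs : bool * M.-tuple bool => [tuple of bs.1 :: bs.2])) /=.
    apply: eq_bigr => -[b s] _; congr f.
    by apply/funext => -[|k].
  exists (fun s => (thead s, [tuple of behead s])) => [[b s] _|s _] /=.
    by congr pair; apply/val_inj.
  by rewrite [s in RHS]tuple_eta; apply/val_inj.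
by rewrite big_bool /= exprS invfM; field; rewrite expf_neq0.
Qed.

Lemma avg0 f : avg 0 f = f (fun=> false).
Proof.
rewrite /avg expr0 invr1 mul1r (bigD1 [tuple])//= big1 ?addr0 => [|s].
  by congr f; apply/funext => k; rewrite /cylinder_point nth_nil.
by move/eqP; case; apply/val_inj; rewrite [s]tuple0.
Qed.

Lemma avg_cst M (c : R) : avg M (fun=> c) = c.
Proof.
rewrite /avg sumr_const card_tuple card_bool -(mulr_natr c) natrX mulrCA.
by rewrite mulVf ?mulr1 ?expf_neq0.
Qed.

Lemma eq_avg M f g : f =1 g -> avg M f = avg M g.
Proof. by move=> /funext ->. Qed.

Lemma avgD M f g : avg M (fun x => f x + g x) = avg M f + avg M g.
Proof. by rewrite /avg big_split mulrDr. Qed.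

Lemma avgZ M c f : avg M (fun x => c * f x) = c * avg M f.
Proof. by rewrite /avg -mulr_sumr mulrCA. Qed.

Lemma avg_sum M (I : Type) (r : seq I) (P : pred I) (f : I -> dyadic -> R) :
  avg M (fun x => \sum_(i <- r | P i) f i x) = \sum_(i <- r | P i) avg M (f i).
Proof. by rewrite /avg exchange_big mulr_sumr. Qed.

Lemma le_avg M f g : (forall x, f x <= g x) -> avg M f <= avg M g.
Proof.
by move=> fg; rewrite ler_wpM2l ?invr_ge0 ?exprn_ge0//; apply: ler_sum.
Qed.

Lemma avg_ge0 M f : (forall x, 0 <= f x) -> 0 <= avg M f.
Proof. by move=> f0; rewrite -(avg_cst M 0); exact: le_avg. Qed.

(** Translation invariance: the first coordinate of [y] keeps or swaps the two halves of the group,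
    and the tail of [y] acts inside each half. *)
Lemma avg_dyadic_add M f y : (forall x z, cylinder M x z -> f x = f z) ->
  avg M (fun x => f (dyadic_add x y)) = avg M f.
Proof.
elim: M f y => [|M ih] f y fM; first by rewrite !avg0; exact: fM.
have fc b x z : cylinder M x z -> f (dyadic_cons b x) = f (dyadic_cons b z).
  by move=> xz; apply: fM => -[|k]// kM; exact: xz.
rewrite !avgS -(ih (f \o dyadic_cons false) (dyadic_tail y)); last exact: fc.
rewrite -(ih (f \o dyadic_cons true) (dyadic_tail y)); last exact: fc.
under eq_avg do rewrite /= dyadic_add_cons.
under [X in _ + X]eq_avg do rewrite /= dyadic_add_cons.
by rewrite /=; case: (y 0%N) => //=; rewrite addrC.
Qed.

Lemma half_decomp n : exists b : bool, exists m, n = (b + m.*2)%N.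
Proof. by exists (odd n), n./2; rewrite odd_double_half. Qed.

(** Both halves of the group carry the product of the shortened Walsh functions, up to signs that
    cancel exactly when the lowest digits differ. *)
Lemma walsh_orthonormal M i j : (i < 2 ^ M)%N -> (j < 2 ^ M)%N ->
  avg M (fun x => w i x * w j x) = (i == j)%:R.
Proof.
elim: M i j => [|M ih] i j.
  by rewrite expn0 !ltnS !leqn0 => /eqP-> /eqP->; rewrite avg0 !walsh0 mulr1.
have [b [i' ->]] := half_decomp i; have [c [j' ->]] := half_decomp j.
rewrite expnS => iM jM.
have {}ih := ih i' j' ltac:(lia) ltac:(lia).
have E a : avg M ((fun x => w (b + i'.*2) x * w (c + j'.*2) x) \o dyadic_cons a) =
   (-1) ^+ (a && b) * (-1) ^+ (a && c) * (i' == j')%:R.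
  rewrite -ih -avgZ; apply: eq_avg => x /=.
  by rewrite !walsh_cons mulrACA.
rewrite avgS !E /=.
have -> : (b + i'.*2 == c + j'.*2)%N = (b == c) && (i' == j').
  by case: b c {iM jM E} => -[]; lia.
by case: b {iM E}; case: c {jM}; rewrite /= ?expr0 ?expr1; lra.
Qed.

Definition dirichlet n x : R := \sum_(j < n) w j x.

Lemma dirichletS n x : dirichlet n.+1 x = dirichlet n x + w n x.
Proof. by rewrite /dirichlet big_ord_recr. Qed.

(** The terms of indices 2j and 2j+1 add up to (1 + (-1)^a) w_j(x). *)
Lemma dirichlet_double n (a : bool) x :
  dirichlet n.*2 (dyadic_cons a x) = (~~ a)%:R * 2 * dirichlet n x.
Proof.
elim: n => [|n ih]; first by rewrite /dirichlet !big_ord0 mulr0.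
rewrite doubleS !dirichletS ih (_ : n.*2.+1 = true + n.*2)%N// walsh_cons.
rewrite -[n.*2]/(false + n.*2)%N walsh_cons.
by case: a {ih} => /=; rewrite ?expr0 ?expr1; lra.
Qed.

Lemma dirichlet_cylinder M n : (n <= 2 ^ M)%N ->
  forall x y, cylinder M x y -> dirichlet n x = dirichlet n y.
Proof.
move=> nM x y xy; apply: eq_bigr => i _; apply: walsh_cylinder xy.
exact: leq_trans nM.
Qed.

(** Iterated doubling. By this formula, convolution with the kernel of order 2^m is the mean over a
    cylinder of depth [m]. *)
Lemma dirichlet_exp2 m x :
  dirichlet (2 ^ m) x = 2 ^+ m * (`[< forall k, (k < m)%N -> x k = false >])%:R.
Proof.
elim: m x => [|m ih] x.
  rewrite expn0 /dirichlet big_ord1 walsh0 expr0 mul1r.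
  by rewrite (asboolT (_ : forall k, _)).
have -> : x = dyadic_cons (x 0%N) (dyadic_tail x) by apply/funext => -[|k].
rewrite expnS mul2n dirichlet_double ih exprS.
set y := dyadic_tail x.
have -> : `[< forall k, (k < m.+1)%N -> dyadic_cons (x 0%N) y k = false >] =
          ~~ x 0%N && `[< forall k, (k < m)%N -> y k = false >].
  apply/asboolP/andP => [h|[/negbTE x0 /asboolP h] [|k]//]; last exact: h.
  split; first by have := h 0%N isT => /= ->.
  by apply/asboolP => k km; exact: (h k.+1).
by case: (x 0%N) => /=; case: asboolP => _ /=; lra.
Qed.

(** For [c := fourier_coef mu F] this is convertible to [partial_sum mu n F], so results on [fsum]
    apply to partial sums directly. *)
Definition fsum (c : nat -> R) n x : R := \sum_(j < n) c j * w j x.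

Lemma fsum_coef c M N i : (N <= 2 ^ M)%N -> (i < 2 ^ M)%N ->
  avg M (fun y => fsum c N y * w i y) = if (i < N)%N then c i else 0.
Proof.
move=> NM iM; under eq_avg do rewrite /fsum mulr_suml.
rewrite avg_sum.
under eq_bigr => j _.
  under eq_avg do rewrite -mulrA.
  rewrite avgZ walsh_orthonormal//; last by exact: leq_trans NM.
  rewrite -[c j * _]/((fun j => c j * (j == i)%:R) (nat_of_ord j)); over.
rewrite -(big_mkord predT (fun j => c j * (j == i)%:R)) /=.
case: ltnP => iN.
  rewrite (bigD1_seq i) ?mem_index_iota ?iota_uniq//= eqxx mulr1 big1 ?addr0//.
  by move=> j /negbTE ->; rewrite mulr0.
rewrite big_nat big1// => j /andP[_ jN].
by rewrite (ltn_eqF (leq_trans jN iN)) mulr0.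
Qed.

(** Since w_i(x + y) = w_i(x) w_i(y), the convolution reads off the coefficients of index below [n]
    by orthonormality. *)
Lemma fsum_dirichlet c M N n x : (N <= 2 ^ M)%N -> (n <= 2 ^ M)%N ->
  avg M (fun y => fsum c N y * dirichlet n (dyadic_add x y)) = fsum c (minn n N) x.
Proof.
move=> NM nM.
have E y : fsum c N y * dirichlet n (dyadic_add x y) =
    \sum_(i < n) w i x * (fsum c N y * w i y).
  rewrite /dirichlet mulr_sumr; apply: eq_bigr => i _.
  by rewrite walsh_add mulrCA.
under eq_avg do rewrite E.
rewrite avg_sum.
under eq_bigr => i _.
  rewrite avgZ fsum_coef//; last exact: leq_trans nM.
  rewrite -[w i x * _]/((fun i => w i x * (if (i < N)%N then c i else 0)) (nat_of_ord i)); over.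
rewrite -(big_mkord predT (fun i => w i x * (if (i < N)%N then c i else 0))).
rewrite /fsum -(big_mkord predT (fun j => c j * w j x)).
rewrite [LHS](big_cat_nat _ (n := minn n N))//= ?geq_minl//.
rewrite [X in _ + X]big_nat [X in _ + X]big1 ?addr0; last first.
  by move=> i; case: (ltnP i N) => iN; rewrite ?mulr0//; lia.
rewrite !big_nat; apply: eq_bigr => i; rewrite /= ltn_min => /andP[_ ->].
exact: mulrC.
Qed.

End walsh_theory.

(** * Subadditivity of powers and p-th power means of Dirichlet kernels *)

Section power_inequalities.
Variables (R : realType) (p : R).
Hypotheses (p_gt0 : 0 < p) (p_le1 : p <= 1).

(** Write (a + b)^p = a (a + b)^(p-1) + b (a + b)^(p-1); as p - 1 <= 0, dropping a summand inside a
    power only increases it. *)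
Lemma powRD_le (a b : R) : 0 <= a -> 0 <= b -> (a + b) `^ p <= a `^ p + b `^ p.
Proof.
have H (x y : R) : 0 <= x -> 0 <= y -> x * (x + y) `^ (p - 1) <= x `^ p.
  rewrite le_eqVlt => /predU1P[<- _|x0 y0]; first by rewrite mul0r powR_ge0.
  rewrite -(mulr_powRB1 (ltW x0) p_gt0) ler_wpM2l ?(ltW x0)//.
  rewrite -opprB !powRN lef_pV2 ?posrE ?powR_gt0 ?ltr_wpDr//.
  by apply: ge0_ler_powR; rewrite ?nnegrE ?subr_ge0 ?addr_ge0 ?lerDl ?(ltW x0).
move=> a0 b0; rewrite -mulr_powRB1 ?addr_ge0// mulrDl lerD ?H//.
by rewrite addrC H.
Qed.

Lemma powR_sum_le (I : Type) (r : seq I) (f : I -> R) : (forall i, 0 <= f i) ->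
  (\sum_(i <- r) f i) `^ p <= \sum_(i <- r) f i `^ p.
Proof.
move=> f0; elim: r => [|i r ih]; first by rewrite !big_nil powR0 ?gt_eqF.
rewrite !big_cons; apply: le_trans (powRD_le _ _) _ => //; first exact: sumr_ge0.
by rewrite lerD2l.
Qed.

(** The first factor is the normalization of the inner average raised to the power [p]; the second
    turns the remaining sum back into an average. *)
Definition convolution_cst M : R := (2 ^- M) `^ p * 2 ^+ M.

(* Subadditivity of [t |-> t `^ p] over the [2 ^ M] points replaces Young's
   inequality, at the price of the factor [2 `^ (M * (1 - p))]. *)
Lemma convolution_le M (g D : dyadic -> R) :
  (forall x y, cylinder M x y -> D x = D y) ->
  avg M (fun x => `|avg M (fun y => g y * D (dyadic_add x y))| `^ p) <=
  convolution_cst M * (avg M (fun x => `|g x| `^ p) * avg M (fun x => `|D x| `^ p)).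
Proof.
move=> DM.
apply: (@le_trans _ _ (avg M (fun x => convolution_cst M *
    avg M (fun y => `|g y| `^ p * `|D (dyadic_add x y)| `^ p)))).
  apply: le_avg => x; rewrite /convolution_cst /avg mulrA mulfK ?expf_neq0//.
  rewrite normrM powRM// ger0_norm ?invr_ge0 ?exprn_ge0// ler_wpM2l ?powR_ge0//.
  apply: (@le_trans _ _ ((\sum_(s : M.-tuple bool) `|g (cylinder_point s)| *
       `|D (dyadic_add x (cylinder_point s))|) `^ p)).
    apply: ge0_ler_powR; rewrite ?nnegrE ?(ltW p_gt0) ?sumr_ge0//.
    by apply: le_trans (ler_norm_sum _ _ _) _; under eq_bigr do rewrite normrM.
  apply: le_trans (powR_sum_le _ _) _ => [s|]; first by rewrite mulr_ge0.
  by under eq_bigr do rewrite powRM//.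
rewrite avgZ ler_wpM2l ?mulr_ge0 ?powR_ge0 ?exprn_ge0//.
(* Exchange the two averages; translation invariance then removes [y] from the kernel. *)
have -> : avg M (fun x => avg M (fun y => `|g y| `^ p * `|D (dyadic_add x y)| `^ p)) =
          avg M (fun y => `|g y| `^ p * avg M (fun x => `|D (dyadic_add x y)| `^ p)).
  rewrite /avg; congr (_ * _); rewrite -mulr_sumr exchange_big /= mulr_sumr.
  by apply: eq_bigr => s _; rewrite mulrCA; congr (_ * _); rewrite mulr_sumr.
rewrite le_eqVlt; apply/orP; left; apply/eqP.
rewrite -[RHS]mulrC -avgZ; apply: eq_avg => y; rewrite mulrC; congr (_ * _).
by apply: (@avg_dyadic_add _ _ (fun x => `|D x| `^ p)) => x z xz; rewrite (DM x z xz).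
Qed.

Let q : R := 2 `^ p / 2.

(** The kernel of order 2n is twice that of order n on one half of the group and 0 on the other,
    whence the factor 2^p / 2. *)
Lemma avg_dirichlet_double M n :
  avg M.+1 (fun x => `|dirichlet R n.*2 x| `^ p) =
  q * avg M (fun x => `|dirichlet R n x| `^ p).
Proof.
rewrite avgS /=.
under eq_avg do rewrite /= dirichlet_double /= mul1r normrM powRM// ger0_norm//.
under [X in _ + X]eq_avg do
  rewrite /= dirichlet_double /= !mul0r normr0 powR0 ?gt_eqF//.
by rewrite avgZ avg_cst addr0 mulrAC.
Qed.

Lemma avg_dirichlet_mul_exp2 l M n :
  avg (l + M) (fun x => `|dirichlet R (2 ^ l * n) x| `^ p) =
  q ^+ l * avg M (fun x => `|dirichlet R n x| `^ p).
Proof.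
elim: l => [|l ih]; first by rewrite mul1n expr0 mul1r.
by rewrite expnS -mulnA mul2n addSn avg_dirichlet_double ih mulrA exprS.
Qed.

Hypothesis p_lt1 : p < 1.

Let q_lt1 : q < 1.
Proof.
rewrite ltr_pdivrMr// mul1r -[ltRHS]powRr1//.
by rewrite /powR (gt_eqF (ltr0Sn _ _)) ltr_expR ltr_pM2r ?ln_gt0// ltr1n.
Qed.

(** Appending a digit turns a mean t into at most q t + 1. As [p < 1] gives [q < 1], this map has
    the fixed point (1 - q)^-1, which bounds all means. *)
Lemma avg_dirichlet_le M n : (n <= 2 ^ M)%N ->
  avg M (fun x => `|dirichlet R n x| `^ p) <= (1 - q)^-1.
Proof.
have q0 : 0 <= q by rewrite divr_ge0 ?powR_ge0.
have C0 : 0 < 1 - q by rewrite subr_gt0.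
have CE : q * (1 - q)^-1 + 1 = (1 - q)^-1.
  have e : (1 - q)^-1 * (1 - q) = 1 by rewrite mulVf// lt0r_neq0.
  by rewrite -[X in _ + X]e; ring.
have C1 : 1 <= (1 - q)^-1 by rewrite -CE lerDr mulr_ge0// invr_ge0 ltW.
elim: M n => [|M ih] n.
  rewrite avg0; case: n => [_|[_|//]].
    by rewrite /dirichlet big_ord0 normr0 powR0 ?gt_eqF// (le_trans _ C1).
  by rewrite /dirichlet big_ord1 walsh0 normr1 powR1.
have [b [m ->]] := half_decomp n; rewrite expnS => nM.
have {}ih : q * avg M (fun x => `|dirichlet R m x| `^ p) <= q * (1 - q)^-1.
  by rewrite ler_wpM2l// ih//; case: b nM; lia.
case: b nM => _; last first.
  by rewrite [(_ + _)%N]/= avg_dirichlet_double (le_trans ih)// -{2}CE lerDl.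
rewrite -[leRHS]CE; apply: le_trans (lerD ih (lexx _)).
rewrite -avg_dirichlet_double -[1](avg_cst M.+1) -avgD; apply: le_avg => x.
have w1 : `|walsh R m.*2 x| `^ p = 1 by rewrite walsh_norm powR1.
rewrite [(_ + _)%N]/= dirichletS -[X in _ <= _ + X]w1.
apply: le_trans (powRD_le _ _) => //.
by apply: ge0_ler_powR; rewrite ?nnegrE ?(ltW p_gt0) ?addr_ge0 ?ler_normD.
Qed.

End power_inequalities.

(** * The variation of an index and the L^1 norm of Dirichlet kernels *)

Section variation.

Lemma bit_variation_widen N n : (n < N)%N ->
  bit_variation n = (bit n 0 + \sum_(0 <= k < N) `|bit n k.+1 - bit n k|)%N.
Proof.
move=> nN; rewrite /bit_variation big_add1 /=; congr (_ + _)%N.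
rewrite [RHS](big_cat_nat _ (n := n))//=; last exact: ltnW.
rewrite [X in (_ + X)%N]big_nat [X in (_ + X)%N]big1 ?addn0//.
by move=> k /andP[nk _]; rewrite !bit_large// (leq_trans nk).
Qed.

(** The summand n_0 counts a change from a digit 0 placed before n_0. The new digit replaces it by b
    + |n_0 - b|, which is larger, by 2, only for b = 1 and n_0 = 0. *)
Lemma bit_variation_double (b : bool) n :
  bit_variation (b + n.*2) = (bit_variation n + 2 * (b && ~~ bit n 0))%N.
Proof.
rewrite (@bit_variation_widen (n.*2.+2)); last by case: b; lia.
rewrite (@bit_variation_widen n.*2.+1 n); last by lia.
rewrite big_nat_recl//= bit0 bitS.
under eq_bigr do rewrite !bitS.
by case: b => /=; case: (bit n 0) => /=; rewrite ?distnn /=; lia.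
Qed.

(** Lets the final estimate for p = 1 absorb 1 + V(n) into 2 V(n). *)
Lemma bit_variation_gt0 n : (0 < n)%N -> (0 < bit_variation n)%N.
Proof.
elim/ltn_ind: n => n ih n0.
have [b [m E]] := half_decomp n; subst n.
rewrite bit_variation_double.
case: (posnP m) => [m0|m0]; last by rewrite addn_gt0 ih//; case: b {ih} n0; lia.
by subst m; case: b n0 {ih} => // _; rewrite bit_large//=; lia.
Qed.

Variable R : realType.

Notation L M n := (avg M (fun x => `|dirichlet R n x|)).

Lemma norm_dirichlet_double M n : L M.+1 n.*2 = L M n.
Proof.
have := @avg_dirichlet_double R 1 ltr01 M n.
rewrite powRr1// mulfV// mul1r.
by under eq_avg do rewrite powRr1//; under [in RHS]eq_avg do rewrite powRr1//.
Qed.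

Lemma norm_dirichlet_doubleS M n : L M.+1 n.*2.+1 <= L M n + 1.
Proof.
rewrite -(norm_dirichlet_double M n) -[1](avg_cst M.+1) -avgD; apply: le_avg => x.
by rewrite dirichletS -(walsh_norm R n.*2 x) ler_normD.
Qed.

Lemma norm_dirichlet_doubleS_sub M n : L M.+1 n.*2.+1 <= L M n.+1 + 1.
Proof.
rewrite -(norm_dirichlet_double M n.+1) -[1](avg_cst M.+1) -avgD; apply: le_avg => x.
rewrite doubleS [X in _ <= `|X| + _]dirichletS -(walsh_norm R n.*2.+1 x).
by rewrite -[X in `|X| <= _](addrK (walsh R n.*2.+1 x)) ler_normB.
Qed.

(* Appending the digit 1 to an [n] that ends in 1 leaves [bit_variation n]
   unchanged; one must then compare with D_{2n+2}, whence the bound for [n.+1]. *)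
Lemma norm_dirichlet_le_variation M n : (n < 2 ^ M)%N ->
  L M n <= (bit_variation n)%:R /\
  L M n.+1 + (2 * bit n 0)%:R <= (bit_variation n).+1%:R.
Proof.
elim: M n => [|M ih] n.
  rewrite expn0 ltnS leqn0 => /eqP ->; rewrite !avg0.
  rewrite /dirichlet big_ord0 big_ord1 walsh0 normr0 normr1 ler0n; split => //.
  by rewrite /bit div0n /= muln0 addr0 ler1n.
have [b [m ->]] := half_decomp n; rewrite expnS => nM.
have [ih1 ih2] := ih m ltac:(by case: b nM; lia).
rewrite bit0 bit_variation_double; case: b {nM} => /=.
  rewrite add1n -doubleS norm_dirichlet_double.
  have h1 := norm_dirichlet_doubleS M m.
  have h2 := norm_dirichlet_doubleS_sub M m.
  (* If [m] ends in 1, the first bound follows from [h2] and [ih2]; if it ends in 0, the variation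
     grows by 2 and [h1] suffices. *)
  move: ih2 ; case: (bit m 0) => /=; rewrite -!natr1 ?addn0 ?natrD ?muln1 ?muln0; lra.
rewrite add0n norm_dirichlet_double muln0 !addn0 addr0; split=> //.
have h1 := norm_dirichlet_doubleS M m.
by rewrite -natr1; lra.
Qed.

End variation.

(** * Lowest and highest nonzero digits *)

Lemma low_bit_dvd n : (2 ^ low_bit n %| n)%N.
Proof.
have H j : (j < low_bit n)%N -> bit n j = false.
  move=> jl; apply/negbTE/negP => bj.
  have jn : (j < n)%N by rewrite ltnNge; apply: contraL bj => /bit_large ->.
  suff : (low_bit n <= j)%N by rewrite leqNgt jl.
  rewrite /low_bit; have := mem_index_enum (Ordinal jn).
  elim: (index_enum _) => // i r ih; rewrite in_cons big_cons.
  case/predU1P => [<-|/ih {}ih]; first by rewrite /= bj geq_minl.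
  by case: ifP => // _; rewrite geq_min ih orbT.
elim: (low_bit n) H => [|t ih] H; first by rewrite dvd1n.
have /dvdnP[m E] : (2 ^ t %| n)%N by apply: ih => j jt; apply: H; exact: ltnW.
have := H t (ltnSn _); rewrite /bit E mulnK ?expn_gt0// => om.
by rewrite expnS dvdn_pmul2r ?expn_gt0// dvdn2 om.
Qed.

(** The top digit sits at position [k], except at the right endpoint 2^(k+1), where it sits at k +
    1. *)
Lemma leq_high_bit k n : (2 ^ k < n <= 2 ^ k.+1)%N -> (k <= high_bit n)%N.
Proof.
move=> /andP[kn nk].
have H j : bit n j -> (j <= high_bit n)%N.
  move=> bj.
  have jn : (j < n)%N by rewrite ltnNge; apply: contraL bj => /bit_large ->.
  exact: (@leq_bigmax_cond _ (fun j : 'I_n => bit n j) _ (Ordinal jn)).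
move: nk; rewrite leq_eqVlt => /predU1P[E|nk].
  by apply: ltnW; apply: H; rewrite /bit E divnn expn_gt0.
apply: H; rewrite /bit.
suff -> : (n %/ 2 ^ k = 1)%N by [].
apply/eqP; rewrite eqn_leq -ltnS ltn_divLR ?expn_gt0// -expnS nk /=.
by rewrite leq_divRL ?expn_gt0// mul1n ltnW.
Qed.

(** * Conditional expectations and martingales as Walsh partial sums *)

Section dyadic_martingales.
Context (R : realType) (mu : probability dyadic R) (mu_haar : is_haar mu).

Lemma integral_avg M (f : dyadic -> R) : zeta_measurable M f ->
  (\int[mu]_x (f x)%:E)%E = (avg M f)%:E.
Proof.
move=> mf.
have cf : forall x y, cylinder M x y -> f x = f y by exact/zeta_measurableP.
rewrite (@zeta_bigcup M setT)// -big_filter.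
rewrite integral_bigsetU_EFin//; last 4 first.
- by move=> s; exact: measurable_cylinder.
- by rewrite filter_uniq// index_enum_uniq.
- move=> s t _ _ [z [zs zt]]; apply/val_inj/(@eq_from_nth _ false).
    by rewrite !size_tuple.
  by move=> k; rewrite size_tuple => kn; rewrite -/(cylinder_point s k) -(zs k kn) (zt k kn).
- by apply: measurable_funTS; apply/measurable_EFinP;
    exact: zeta_measurable_measurable mf.
rewrite big_filter /avg mulr_sumr -sumEFin.
apply: eq_big => [s|s _]; first exact/asboolP.
under eq_integral => y /set_mem yx do rewrite -(cf _ y yx).
rewrite integral_cst; last exact: measurable_cylinder.
have := haar_cylinder M (cylinder_point s) mu_haar => /= ->.
by rewrite -EFinM mulrC.
Qed.

Lemma Rintegral_avg M (f : dyadic -> R) : zeta_measurable M f ->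
  \int[mu]_x f x = avg M f.
Proof. by move=> mf; rewrite /Rintegral (integral_avg mf). Qed.

Lemma avg_dirichlet_expand M n (f : dyadic -> R) x :
  avg M (fun y => f y * dirichlet R n (dyadic_add x y)) =
  fsum (fun j => avg M (fun y => f y * walsh R j y)) n x.
Proof.
under eq_avg do rewrite /dirichlet mulr_sumr.
rewrite avg_sum; apply: eq_bigr => j _.
by rewrite mulrC -avgZ; apply: eq_avg => y; rewrite walsh_add mulrCA.
Qed.

(** The conditional expectation at [x] is the mean over [cylinder m x], whose normalized indicator
    is the kernel of order 2^m at x + y; expanding that kernel gives a partial sum. *)
Lemma is_cond_expE m M (f g : dyadic -> R) : (m <= M)%N ->
  zeta_measurable M f -> is_cond_exp mu m f g ->
  g = fsum (fun j => avg M (fun y => f y * walsh R j y)) (2 ^ m).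
Proof.
move=> mM /zeta_measurableP fM fg; apply/funext => x.
rewrite -avg_dirichlet_expand (is_cond_exp_mean mu_haar x fg) Rintegral_mkcond.
rewrite (@Rintegral_avg M); last first.
  apply/zeta_measurableP => y z yz; rewrite /patch (fM y z yz).
  suff -> : (y \in cylinder m x) = (z \in cylinder m x) by [].
  apply/idP/idP => /set_mem h; apply/mem_set => k km.
    by rewrite yz ?h// (leq_trans km).
  by rewrite -yz ?h// (leq_trans km).
rewrite -avgZ; apply: eq_avg => y.
rewrite dirichlet_exp2 /patch mulrCA; congr (_ * _).
have -> : (y \in cylinder m x) = `[< forall k, (k < m)%N -> dyadic_add x y k = false >].
  apply/idP/asboolP => [/set_mem h k km|h].
    by rewrite /dyadic_add h// addbb.
  apply/mem_set => k km; have := h k km; rewrite /dyadic_add.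
  by case: (x k); case: (y k).
by case: asboolP; rewrite ?mulr1 ?mulr0.
Qed.

Lemma zeta_measurable_fsum c M n : (n <= 2 ^ M)%N ->
  zeta_measurable M (fsum c n : dyadic -> R).
Proof.
move=> nM; apply/zeta_measurableP => x y xy; apply: eq_bigr => j _.
by rewrite (walsh_cylinder _ (leq_trans (ltn_ord j) nM) xy).
Qed.

Lemma zeta_measurable_integrable M (f : dyadic -> R) : zeta_measurable M f ->
  mu.-integrable setT (EFin \o f).
Proof.
move=> fM; apply/integrableP; split.
  by apply/measurable_EFinP; exact: zeta_measurable_measurable fM.
rewrite (@integral_avg M (fun x => `|f x|)) ?ltry//.
by apply/zeta_measurableP => x y xy; move/zeta_measurableP: fM => /(_ x y xy) ->.
Qed.

Lemma cond_exp_fsum c m n :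
  cond_exp mu m (fsum c n) = fsum c (minn n (2 ^ m)) :> (dyadic -> R).
Proof.
(* The depth [m + n] serves both requirements: it is at least [m], and it resolves all indices below
   [n]. *)
have nM : (n <= 2 ^ (m + n))%N.
  by apply: ltnW; apply: leq_trans (ltn_expl n (ltnSn 1)) _; rewrite leq_exp2l ?leq_addl.
have mM : (m <= m + n)%N by exact: leq_addr.
have fM := zeta_measurable_fsum c nM.
have h := cond_expP mu_haar m (zeta_measurable_integrable fM).
rewrite (is_cond_expE mM fM h); apply/funext => x.
rewrite -avg_dirichlet_expand fsum_dirichlet//; first by rewrite minnC.
by rewrite leq_exp2l.
Qed.

Variables (F : nat -> dyadic -> R).
Hypothesis mF : martingale mu F.

Let zF m : zeta_measurable m (F m). Proof. by case: (mF m). Qed.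

Let d m j := avg m (fun y => F m y * walsh R j y).

(** The coefficients are those of level [m.+1], because the martingale property gives F_m as a
    conditional expectation of F_(m+1). *)
Let FE m : F m = fsum (d m.+1) (2 ^ m).
Proof. exact: (is_cond_expE (leqnSn m) (@zF m.+1) (mF m)). Qed.

Let dS m j : (j < 2 ^ m)%N -> d m j = d m.+1 j.
Proof. by move=> jm; rewrite {1}/d {1}FE fsum_coef// jm. Qed.

(** By [dS] the sequence in the limit defining [fourier_coef] is constant from level [m] on. *)
Let d_fourier m j : (j < 2 ^ m)%N -> fourier_coef mu F j = d m j.
Proof.
move=> jm; apply: lim_near_cst; first exact: norm_hausdorff.
exists m => // n /= mn.
have jn t : (j < 2 ^ (m + t))%N by rewrite (leq_trans jm)// leq_exp2l// leq_addr.
rewrite -(subnKC mn) (@Rintegral_avg (m + (n - m))); last first.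
  apply/zeta_measurableP => x y xy; rewrite (walsh_cylinder _ (jn _) xy).
  by move/zeta_measurableP: (@zF (m + (n - m))) => /(_ x y xy) ->.
rewrite -/(d _ _); elim: (n - m)%N => [|t ih]; first by rewrite addn0.
by rewrite addnS -dS.
Qed.

Lemma martingaleE m : F m = fsum (fourier_coef mu F) (2 ^ m).
Proof.
apply/funext => x; rewrite {1}FE; apply: eq_bigr => j _; congr (_ * _).
by rewrite (@d_fourier m.+1)// (leq_trans (ltn_ord j))// leq_exp2l.
Qed.

End dyadic_martingales.

(** * Maximal functions and Hardy norms *)

Section hardy_norm.
Context (R : realType) (mu : probability dyadic R).

Lemma HnormE p (F : nat -> dyadic -> R) :
  Hnorm mu p F = ((\int[mu]_x (maximal_function F x `^ p)) `^ p^-1)%E.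
Proof.
rewrite /Hnorm unlock; congr (_ `^ _)%E; apply: eq_integral => x _.
rewrite gee0_abs//; apply: le_trans (ereal_sup_ubound _); last by exists 0%N.
by rewrite lee_fin.
Qed.

Lemma maximal_function_ubound (F : nat -> dyadic -> R) m x :
  (`|F m x|%:E <= maximal_function F x)%E.
Proof. by apply: ereal_sup_ubound; exists m. Qed.

Lemma maximal_function_ge0 (F : nat -> dyadic -> R) x :
  (0 <= maximal_function F x)%E.
Proof. by apply: le_trans (maximal_function_ubound F 0 x); rewrite lee_fin. Qed.

Lemma measurable_maximal_function (F : nat -> dyadic -> R) :
  (forall m, zeta_measurable m (F m)) -> measurable_fun setT (maximal_function F).
Proof.
move=> mF.
have -> : maximal_function F = fun x => esups (fun n => `|F n x|%:E) 0.
  apply/funext => x; congr ereal_sup.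
  by apply/seteqP; split => [_ [n _ <-]|_ [n _ <-]]; exists n.
apply: measurable_fun_esups => n; apply/measurable_EFinP.
by apply: measurableT_comp => //; exact: zeta_measurable_measurable (mF n).
Qed.

End hardy_norm.

Lemma poweRD_le (R : realType) (p : R) (x y : \bar R) : 0 < p -> p <= 1 ->
  (0 <= x)%E -> (0 <= y)%E -> ((x + y) `^ p <= x `^ p + y `^ p)%E.
Proof.
move=> p0 p1; have pn0 : p != 0 by rewrite gt_eqF.
case: x y => [x| |] [y| |]// x0 y0.
- by rewrite -EFinD !poweR_EFin -EFinD lee_fin powRD_le.
- by rewrite (poweRyr pn0) addey ?leey// -ltNye poweR_EFin.
- by rewrite (poweRyr pn0) addye ?leey// -ltNye poweR_EFin.
- by rewrite (poweRyr pn0) addye ?leey// -ltNye poweR_EFin.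
Qed.

(** * From a kernel bound to the approximation estimate *)

Section partial_sum_bound.
Context (R : realType) (mu : probability dyadic R) (mu_haar : is_haar mu).
Context (p : R) (p_gt0 : 0 < p) (p_le1 : p <= 1).

Let p_ge0 : 0 <= p. Proof. exact: ltW. Qed.

(** Shared by p < 1 and p = 1, which differ only in the kernel bound [B]. In the constant, 1
    accounts for the maximal function of F - S_{2^k} F and the other term for S_n F - S_{2^k} F. *)
Lemma Hnorm_partial_sum_le (k n : nat) (B : R) (F : nat -> dyadic -> R) :
  (2 ^ k < n <= 2 ^ k.+1)%N -> martingale mu F ->
  avg k.+2 (fun x => `|dirichlet R n x| `^ p) <= B ->
  (Hnorm mu p (martingale_sub (martingale_of mu (partial_sum mu n F)) F) <=
   ((1 + convolution_cst p k.+2 * B) `^ p^-1)%:E * modulus mu p k F)%E.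
Proof.
move=> /andP[kn nk] mF avgB.
set c := fourier_coef mu F.
have FE m : F m = fsum c (2 ^ m) := martingaleE mu_haar mF m.
have kM : (2 ^ k <= 2 ^ k.+2)%N by rewrite leq_exp2l//; lia.
have nM : (n <= 2 ^ k.+2)%N by rewrite (leq_trans nk)// leq_exp2l.
set G := martingale_sub F (martingale_of mu (partial_sum mu (2 ^ k) F)).
set D := martingale_sub _ F.
have GE m x : G m x = fsum c (2 ^ m) x - fsum c (minn (2 ^ k) (2 ^ m)) x.
  by rewrite /G /martingale_sub /martingale_of (cond_exp_fsum mu_haar) FE.
have DE m x : D m x = fsum c (minn n (2 ^ m)) x - fsum c (2 ^ m) x.
  by rewrite /D /martingale_sub /martingale_of (cond_exp_fsum mu_haar) FE.
have zfsum m N : (N <= 2 ^ m)%N -> zeta_measurable m (fsum c N).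
  exact: zeta_measurable_fsum.
have zsub m (f g : dyadic -> R) : zeta_measurable m f -> zeta_measurable m g ->
    zeta_measurable m (fun x => f x - g x).
  move=> /zeta_measurableP hf /zeta_measurableP hg; apply/zeta_measurableP => x y xy.
  by rewrite (hf x y xy) (hg x y xy).
have znorm m (f : dyadic -> R) : zeta_measurable m f ->
    zeta_measurable m (fun x => `|f x| `^ p).
  by move=> /zeta_measurableP hf; apply/zeta_measurableP => x y xy; rewrite (hf x y xy).
have zG m : zeta_measurable m (G m).
  rewrite (_ : G m = fun x => fsum c (2 ^ m) x - fsum c (minn (2 ^ k) (2 ^ m)) x).
    by apply: zsub; apply: zfsum; rewrite ?geq_minr.
  by apply/funext => x; rewrite GE.
have zD m : zeta_measurable m (D m).
  rewrite (_ : D m = fun x => fsum c (minn n (2 ^ m)) x - fsum c (2 ^ m) x).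
    by apply: zsub; apply: zfsum; rewrite ?geq_minr.
  by apply/funext => x; rewrite DE.
pose f x := fsum c n x - fsum c (2 ^ k) x.
have zf : zeta_measurable k.+2 f by apply: zsub; exact: zfsum.
(* Convolution with the kernel truncates S_{2^(k+2)} F at [n] and leaves S_{2^k} F unchanged, as 2^k
   < n. *)
have fE x : f x = avg k.+2 (fun y => G k.+2 y * dirichlet R n (dyadic_add x y)).
  under eq_avg do rewrite GE (minn_idPl kM) mulrBl.
  rewrite (_ : avg _ _ = avg k.+2 (fun y => fsum c (2 ^ k.+2) y * dirichlet R n (dyadic_add x y))
    + (-1) * avg k.+2 (fun y => fsum c (2 ^ k) y * dirichlet R n (dyadic_add x y))); last first.
    by rewrite -avgZ -avgD; apply: eq_avg => y; rewrite mulN1r.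
  rewrite !fsum_dirichlet// (minn_idPl nM) (minn_idPr (ltnW kn)).
  by rewrite mulN1r.
have DfG x : (maximal_function D x <= `|f x|%:E + maximal_function G x)%E.
  apply: ub_ereal_sup => _ [m _ <-].
  apply: le_trans (leeD2l _ (maximal_function_ubound G m x)).
  rewrite -EFinD lee_fin DE GE /f.
  have [mk|km] := leqP m k.
    rewrite (minn_idPr _) ?subrr ?normr0 ?addr_ge0//.
    by apply: leq_trans (ltnW kn); rewrite leq_exp2l.
  have nm : (n <= 2 ^ m)%N by rewrite (leq_trans nk)// leq_exp2l.
  rewrite (minn_idPl nm) (minn_idPl (_ : 2 ^ k <= 2 ^ m)%N) ?leq_exp2l ?(ltnW km)//.
  by apply: le_trans (ler_normB _ _); rewrite opprB addrA subrK.
have mmax H : (forall m, zeta_measurable m (H m)) ->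
    measurable_fun setT (fun x => maximal_function H x `^ p)%E.
  move=> zH; apply: (@measurableT_comp _ _ _ _ _ _ (fun x => x `^ p)%E).
    exact: measurable_poweR.
  exact: measurable_maximal_function.
have mf m (h : dyadic -> R) : zeta_measurable m h ->
    measurable_fun setT (fun x => (`|h x| `^ p)%:E).
  move=> zh; apply/measurable_EFinP.
  exact: (zeta_measurable_measurable (znorm _ _ zh)).
rewrite /modulus -/G !HnormE; set IG := (\int[mu]_x (maximal_function G x `^ p))%E.
have IG0 : (0 <= IG)%E by apply: integral_ge0 => x _; exact: poweR_ge0.
have cst0 : 0 <= convolution_cst p k.+2 by rewrite mulr_ge0 ?powR_ge0 ?exprn_ge0.
have B0 : 0 <= B by apply: le_trans avgB; apply: avg_ge0 => x; exact: powR_ge0.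
have CB0 : 0 <= convolution_cst p k.+2 * B by exact: mulr_ge0.
have If : (\int[mu]_x (`|f x| `^ p)%:E <= (convolution_cst p k.+2 * B)%:E * IG)%E.
  apply: (@le_trans _ _ ((convolution_cst p k.+2 * B)%:E *
      \int[mu]_x (`|G k.+2 x| `^ p)%:E)%E).
    rewrite (integral_avg mu_haar (znorm _ _ zf)).
    rewrite (integral_avg mu_haar (znorm _ _ (zG k.+2))) -EFinM lee_fin.
    under eq_avg do rewrite fE.
    apply: le_trans (convolution_le p_gt0 p_le1 _ _) _.
      exact: dirichlet_cylinder.
    rewrite -(mulrA (convolution_cst p k.+2) B) ler_wpM2l// mulrC ler_wpM2r//.
    by apply: avg_ge0 => x; exact: powR_ge0.
  (* The single level [k.+2] of [G] is dominated by its maximal function. *)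
  apply: lee_wpmul2l; first by rewrite lee_fin.
  apply: ge0_le_integral => //.
  - exact: (mf _ _ (zG _)).
  - exact: mmax.
  move=> x _; rewrite -poweR_EFin; apply: gt0_ler_poweR => //.
  - by rewrite in_itv/= leey lee_fin normr_ge0.
  - by rewrite in_itv/= leey maximal_function_ge0.
  exact: (maximal_function_ubound G k.+2 x).
have ID : (\int[mu]_x (maximal_function D x `^ p) <=
           (1 + convolution_cst p k.+2 * B)%:E * IG)%E.
  apply: (@le_trans _ _ (\int[mu]_x ((`|f x| `^ p)%:E + maximal_function G x `^ p))%E).
    apply: ge0_le_integral => //.
    - by move=> x _; exact: poweR_ge0.
    - exact: mmax.
    - by apply: emeasurable_funD; [exact: mf zf|exact: mmax].
    move=> x _; rewrite -poweR_EFin.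
    apply: le_trans (poweRD_le p_gt0 p_le1 _ _) => //; last exact: maximal_function_ge0.
    apply: gt0_ler_poweR => //.
      by rewrite in_itv/= maximal_function_ge0 leey.
    by rewrite in_itv/= adde_ge0 ?maximal_function_ge0 ?leey.
  rewrite ge0_integralD//; last 3 first.
  - exact: mf zf.
  - by move=> x _; exact: poweR_ge0.
  - exact: mmax.
  rewrite EFinD ge0_muleDl ?lee_fin// mul1e addeC leeD2l//.
rewrite -poweR_EFin -poweRM//; last by rewrite lee_fin addr_ge0.
apply: gt0_ler_poweR => //; first by rewrite invr_ge0.
  by rewrite in_itv/= leey andbT; apply: integral_ge0 => x _; exact: poweR_ge0.
by rewrite in_itv/= leey andbT mule_ge0// lee_fin addr_ge0.
Qed.

End partial_sum_bound.

(** * Conclusion: the constants in the two cases *)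

Lemma convolution_cstE (R : realType) (p : R) M :
  convolution_cst p M = (2 `^ (1 - p)) ^+ M.
Proof.
have e : (2 ^- M : R) = 2 `^ (- M%:R) by rewrite powRN powR_mulrn.
rewrite /convolution_cst e -powRrM -(powR_mulrn M (ler0n R 2)).
rewrite -powRD; last by rewrite implybE pnatr_eq0 orbT.
rewrite -(powR_mulrn M (powR_ge0 _ _)) -powRrM; congr (_ `^ _); ring.
Qed.

Theorem theorem3 (R : realType) (mu : probability dyadic R) (mu_haar : is_haar mu)
    (p : R) (p_gt0 : 0 < p) (p_le1 : p <= 1) :
  exists c : R, forall k n : nat, (2 ^ k < n <= 2 ^ k.+1)%N ->
    (p < 1 -> forall F : nat -> dyadic -> R, hardy mu p F ->
       (Hnorm mu p (martingale_sub (martingale_of mu (partial_sum mu n F)) F)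
        <= (c * 2 `^ ((bit_spread n)%:R * (p^-1 - 1)))%:E * modulus mu p k F)%E)
    /\
    (p = 1 -> forall F : nat -> dyadic -> R, hardy mu 1 F ->
       (Hnorm mu 1 (martingale_sub (martingale_of mu (partial_sum mu n F)) F)
        <= (c * (bit_variation n)%:R)%:E * modulus mu 1 k F)%E).
Proof.
have [p1|p1] := eqVneq p 1.
  (* For p = 1 the convolution constant is 1, so the bound is 1 + V(n) <= 2 V(n). *)
  exists 2 => k n kn; split=> [|_ F [mF _]]; first by rewrite p1 ltxx.
  have n0 : (0 < n)%N by case/andP: kn => /(leq_ltn_trans _) ->.
  (* The variation bound asks for a strict inequality, which fails at depth k + 1 for n = 2^(k+1);
     hence depth k + 2. *)
  have nM : (n < 2 ^ k.+2)%N.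
    by case/andP: kn => _ nk; rewrite (leq_ltn_trans nk)// ltn_exp2l.
  have [L _] := norm_dirichlet_le_variation R nM.
  have {}L : avg k.+2 (fun x => `|dirichlet R n x| `^ 1) <= (bit_variation n)%:R.
    by under eq_avg do rewrite powRr1//.
  apply: le_trans (Hnorm_partial_sum_le mu_haar ltr01 (lexx 1) kn mF L) _.
  apply: lee_wpmul2r; first by rewrite /modulus HnormE poweR_ge0.
  rewrite lee_fin convolution_cstE subrr powRr0 expr1n mul1r invr1 powRr1 ?addr_ge0//.
  by rewrite mulr_natl mulr2n lerD2r ler1n bit_variation_gt0.
have p_lt1 : p < 1 by rewrite lt_neqAle p1.
(* Each doubling of the index multiplies the kernel mean by r^-1, while the convolution constant at
   depth M is r^M. *)
set r : R := 2 `^ (1 - p).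
have r1 : 1 <= r by rewrite -[1](powRr0 2) ler_powR// ?ler1n// subr_ge0.
have r0 : 0 < r by rewrite (lt_le_trans ltr01).
have qE : 2 `^ p / 2 = r^-1.
  by rewrite /r powRB ?implybE ?pnatr_eq0 ?orbT// powRr1// invf_div.
have C0 : 0 <= (1 - r^-1)^-1 by rewrite invr_ge0 subr_ge0 invf_le1.
(* Here (1 - r^-1)^-1 is the uniform kernel bound, and r^2 pays for k + 2 - <n> <= d(n) + 2. *)
exists ((1 + (1 - r^-1)^-1 * r ^+ 2) `^ p^-1) => k n kn; split=> [_ F [mF _]|p1E];
  last by rewrite p1E eqxx in p1.
have n0 : (0 < n)%N by case/andP: kn => /(leq_ltn_trans _) ->.
have /dvdnP[m nE] := low_bit_dvd n; rewrite mulnC in nE.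
have m0 : (0 < m)%N by move: n0; rewrite {1}nE muln_gt0 => /andP[].
set l := low_bit n in nE.
have nM : (n <= 2 ^ k.+2)%N.
  by case/andP: kn => _ nk; rewrite (leq_trans nk)// leq_exp2l.
have lM : (l <= k.+2)%N.
  by rewrite -(@leq_exp2l 2)// (leq_trans _ nM)// {1}nE leq_pmulr.
have mM : (m <= 2 ^ (k.+2 - l))%N.
  by rewrite -(@leq_pmul2l (2 ^ l)) ?expn_gt0// -expnD subnKC// -nE.
(* With n = 2^l m, the [l] doublings give r^-l and the kernel of order [m] obeys the uniform
   bound. *)
have L : avg k.+2 (fun x => `|dirichlet R n x| `^ p) <= r ^- l * (1 - r^-1)^-1.
  rewrite {1}nE -{1}(subnKC lM) avg_dirichlet_mul_exp2// qE exprVn.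
  by rewrite ler_wpM2l ?invr_ge0 ?exprn_ge0 ?(ltW r0)// -qE avg_dirichlet_le.
apply: le_trans (Hnorm_partial_sum_le mu_haar p_gt0 p_le1 kn mF L) _.
apply: lee_wpmul2r; first by rewrite /modulus HnormE poweR_ge0.
have dE : 2 `^ ((bit_spread n)%:R * (p^-1 - 1)) = (r ^+ bit_spread n) `^ p^-1.
  rewrite -powR_mulrn ?(ltW r0)// /r -!powRrM; congr (_ `^ _).
  by field; rewrite gt_eqF.
have rX i : 0 <= r ^+ i by rewrite exprn_ge0 ?(ltW r0).
have K0 : 0 <= 1 + (1 - r^-1)^-1 * r ^+ 2 by rewrite addr_ge0// mulr_ge0.
rewrite lee_fin dE -powRM//.
apply: ge0_ler_powR; rewrite ?nnegrE ?invr_ge0 ?(ltW p_gt0)//.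
- rewrite convolution_cstE -/r addr_ge0// mulr_ge0// mulr_ge0//.
  by rewrite invr_ge0.
- exact: mulr_ge0.
rewrite convolution_cstE -/r mulrDl mul1r lerD ?exprn_ege1//.
rewrite [leLHS]mulrA [leLHS]mulrC -[leRHS]mulrA ler_wpM2l//.
(* The decay r^-l of the kernel cancels against the convolution constant r^(k+2), leaving
   r^(k+2-l). *)
have {1}-> : k.+2 = (k.+2 - l + l)%N by rewrite subnK.
rewrite exprD mulfK ?gt_eqF ?exprn_gt0// -exprD ler_weXn2l//.
have := leq_high_bit kn; rewrite /bit_spread -/l; lia.
Qed.
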